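(* Let $n, r$ be positive integers. For real $x>-1$ let $$\beta_n(x)=-\sum_{k=0}^{n}\frac{1}{x+2k+1},$$ and define functions $f_{n,s}(x)$, $s\ge 1$, by the recurrence $$f_{n,1}(x)=\beta_n(x),\qquad f_{n,s+1}(x)=\beta_n(x)f_{n,s}(x)+\frac{d}{dx}f_{n,s}(x)\quad (s\ge 1).$$ Then $$(-1)^{r}r!\sum_{k=0}^{n}\binom{n}{k}(-1)^{k}\frac{1}{(2k+1)^{r+1}}=\frac{2^{2n}}{(2n+1)\binom{2n}{n}}\,f_{n,r}(0),$$ and (summing over all positive integers $n$, with $r$ fixed) $$\sum_{n=1}^{\infty}\frac{2^{2n-1}}{n(2n+1)\binom{2n}{n}}\,f_{n,r}(0)=(-1)^{r}(r+1)!.$$ Moreover, for every $s\ge 1$, $f_{n,s}(x)$ is a polynomial, with real coefficients not depending on $x$, in $\beta_n(x),\beta_n^{(1)}(x),\dots,\beta_n^{(s-1)}(x)$, and $$\beta_n^{(j)}(0)=(-1)^{j-1}\,j!\,\Big(H_{2n+1}^{(j+1)}-\frac{1}{2^{j+1}}H_{n}^{(j+1)}\Big)\qquad (j\ge 0).$$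
   Context: For positive integers $m$ and $r$, the harmonic number of order $r$ is $H_m^{(r)}=\sum_{i=1}^{m}\frac{1}{i^{r}}$. For $j\ge 0$, $\beta_n^{(j)}(x)$ denotes the $j$-th derivative of $\beta_n(x)$ with respect to $x$, with $\beta_n^{(0)}=\beta_n$. *)

(* Defs.v *)
From HB Require Import structures.
From mathcomp Require Import all_boot all_order all_algebra.
From mathcomp Require Import all_classical all_reals all_analysis.
From mathcomp Require mpoly.

Set Implicit Arguments.
Unset Strict Implicit.
Unset Printing Implicit Defensive.

Import Order.TTheory GRing.Theory Num.Theory.
Import numFieldNormedType.Exports.
Local Open Scope classical_set_scope.
Local Open Scope ring_scope.

Definition harmonic_number {R : realType} (m r : nat) : R :=
  \sum_(1 <= i < m.+1) 1 / i%:R ^+ r.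

(* Only the values of [betan n] and [fns n s] at x > -1 are meaningful. *)
Definition betan {R : realType} (n : nat) (x : R) : R :=
  - \sum_(0 <= k < n.+1) 1 / (x + 2 * k%:R + 1).

(* Indexed from s = 1; the value at s = 0 is a dummy. *)
Definition fns {R : realType} (n s : nat) : R -> R :=
  iter s.-1 (fun (g : R -> R) x => betan n x * g x + derive1 g x) (betan n).

(* The derivatives involved exist on x > -1, so that the total operators
   [derive1] and [derive1n] never take an arbitrary value there: all the
   functions concerned agree on x > -1 with a member of the following class. *)
Inductive elementary {R : realType} : (R -> R) -> Prop :=
| elem_cst c : elementary (fun=> c)
| elem_inv c : 1 <= c -> elementary (fun x => (x + c)^-1)
| elem_add g h :
    elementary g -> elementary h -> elementary (fun x => g x + h x)
| elem_mul g h :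
    elementary g -> elementary h -> elementary (fun x => g x * h x).

Lemma elementary_is_derive (R : realType) (g : R -> R) : elementary g ->
  exists2 g' : R -> R,
    elementary g' & forall x : R, -1 < x -> is_derive x 1 g (g' x).
Proof.
elim=> [c|c c1|{}g h _ [g' eg' dg] _ [h' eh' dh]|{}g h eg [g' eg' dg] eh].
- by exists (fun=> 0) => [|x _]; [exact: elem_cst | exact: is_derive_cst].
- exists (fun x => -1 * ((x + c)^-1 * (x + c)^-1)) => [|x x1].
    by do ![apply: elem_mul | exact: elem_cst | exact: elem_inv].
  have xc0 : x + c != 0.
    by rewrite gt_eqF// -(subrr 1) addrC ltr_leD // addrC.
  have dxc : is_derive x 1 (fun y : R => y + c) 1.
    rewrite -[X in is_derive _ _ _ X]addr0.
    exact: (@is_deriveD _ _ _ id (cst c) x 1 1 0).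
  have dV := @is_deriveV R (fun y => y + c) x 1 1 xc0 dxc; apply: is_derive_eq.
  by rewrite scaleNr mulN1r /GRing.scale /= mulr1 expr2 invfM.
- exists (fun x => g' x + h' x) => [|x x1]; first exact: elem_add.
  by have := dg x x1; have := dh x x1; move=> ? ?; exact: is_deriveD.
- move=> [h' eh' dh]; exists (fun x => g x * h' x + h x * g' x) => [|x x1].
    by apply: elem_add; apply: elem_mul.
  by have := dg x x1; have := dh x x1; move=> ? ?; exact: is_deriveM.
Qed.

Lemma elementary_derive1 (R : realType) (F g : R -> R) :
    elementary g -> (forall x, -1 < x -> F x = g x) ->
  exists2 g' : R -> R, elementary g' &
    forall x, -1 < x -> derivable F x 1 /\ derive1 F x = g' x.
Proof.
move=> eg Fg; have [g' eg' dg] := elementary_is_derive eg.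
exists g' => // x x1; have [dgx gx] := dg x x1.
have nFg : \near x, F x = g x by near=> y; apply: Fg; near: y; exact: lt_nbhsr.
split; last by rewrite derive1E (near_eq_derive _ nFg).
apply: near_eq_derivable dgx.
by apply: filterS nFg => y ->.
Unshelve. all: by end_near. Qed.

Lemma betan_elementary (R : realType) n : elementary (@betan R n).
Proof.
have -> : @betan R n =
    fun x => -1 * \sum_(0 <= k < n.+1) (x + (2 * k%:R + 1))^-1.
  apply/funext => x; rewrite mulN1r; congr (- _).
  by apply: eq_bigr => k _; rewrite mul1r addrA.
apply: elem_mul; first exact: elem_cst.
elim: n.+1 => [|m IH].
  have -> : (fun x : R => \sum_(0 <= k < 0) (x + (2 * k%:R + 1))^-1) = fun=> 0.
    by apply/funext => x; rewrite big_nil.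
  exact: elem_cst.
have -> : (fun x : R => \sum_(0 <= k < m.+1) (x + (2 * k%:R + 1))^-1) =
    fun x => \sum_(0 <= k < m) (x + (2 * k%:R + 1))^-1 +
             (x + (2 * m%:R + 1))^-1.
  by apply/funext => x; rewrite big_nat_recr.
by apply: elem_add => //; apply: elem_inv; rewrite lerDr mulr_ge0.
Qed.

Lemma derivable_derive1n_betan (R : realType) n j (x : R) : -1 < x ->
  derivable (derive1n j (@betan R n)) x 1.
Proof.
move=> x1; have [g eg bg] : exists2 g : R -> R, elementary g &
    forall y, -1 < y -> derive1n j (@betan R n) y = g y.
  elim: j => [|j [g eg bg]].
    by exists (betan n) => //; exact: betan_elementary.
  have [g' eg' dF] := elementary_derive1 eg bg.
  by exists g' => // y /dF[].
by have [g' _ /(_ x x1)[]] := elementary_derive1 eg bg.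
Qed.

Lemma derivable_fns (R : realType) n s (x : R) : -1 < x ->
  derivable (@fns R n s) x 1.
Proof.
move=> x1; have [g eg fg] : exists2 g : R -> R, elementary g &
    forall y, -1 < y -> @fns R n s y = g y.
  rewrite /fns; elim: s.-1 => [|m [g eg fg]].
    by exists (betan n) => //; exact: betan_elementary.
  have [g' eg' dF] := elementary_derive1 eg fg.
  exists (fun y => betan n y * g y + g' y) => [|y y1].
    by apply: elem_add => //; apply: elem_mul => //; exact: betan_elementary.
  by rewrite iterS (dF y y1).2 fg.
by have [g' _ /(_ x x1)[]] := elementary_derive1 eg fg.
Qed.

(* Main.v *)
(** Let [y x = \sum_(k <= n) 'C(n, k) (-1)^k / (x + 2k + 1)].  Pascal-type
    recurrences give [y' = betan n * y], hence [y^(r) = fns n r * y]; evaluating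
    both expressions of [y^(r)] at [0], where [y 0] is the stated closed form,
    yields the finite identity.
    For the series, put [a_n(s) = \sum_k 'C(n, k) (-1)^k / (2k+1)^s].  The
    recurrence [2n (a_n(s+1) - a_{n-1}(s+1)) = a_n(s) - a_n(s+1)] makes
    [S_N(s) = \sum_(1 <= n <= N) a_n(s) / (2n)] satisfy
    [S_N(s+1) = S_N(s) + 1 - a_N(s+1)].  As [a_n(s) >= 0], [S_N(s)] increases
    and is bounded by [s], so [a_N(s+1)] converges, necessarily to [0] because
    the harmonic series diverges; thus [S_N(s)] tends to [s]. *)

Require Import Defs.
From mathcomp Require Import all_boot all_order all_algebra.
From mathcomp Require Import all_classical all_reals all_analysis.
From mathcomp Require mpoly.
From mathcomp Require Import ring lra zify.
Import -(notations) mpoly.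
Import Order.TTheory GRing.Theory Num.Theory.
Import numFieldNormedType.Exports.
Local Open Scope classical_set_scope.
Local Open Scope ring_scope.

(** * Sums over the poles -1, -3, -5, ...: derivatives and recurrences *)

(** Both [betan] and the alternating binomial sums are instances, so termwise differentiation is
    done only once. *)
Definition odd_pole_sum {R : realType} (c : nat -> R) (m s : nat) (x : R) : R :=
  \sum_(0 <= k < m) c k * (x + (2 * k + 1)%:R)^-1 ^+ s.

Definition alt_binomial_sum {R : realType} (n : nat) : nat -> R -> R :=
  odd_pole_sum (fun k => 'C(n, k)%:R * (-1) ^+ k) n.+1.

Lemma odd_pole_gt0 {R : realType} {x : R} k :
  -1 < x -> 0 < x + (2 * k + 1)%:R.
Proof. by rewrite natrD => x1; have := ler0n R (2 * k); lra. Qed.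

Lemma is_derive_odd_pole_sum {R : realType} (c : nat -> R) m s {x : R} :
  -1 < x ->
  is_derive x 1 (odd_pole_sum c m s) (- s%:R * odd_pole_sum c m s.+1 x).
Proof.
move=> x1; elim: m => [|m IH].
  have -> : odd_pole_sum c 0 s = cst 0.
    by apply/funext => y; rewrite /odd_pole_sum big_nil.
  by rewrite /odd_pole_sum big_nil mulr0; exact: is_derive_cst.
pose a : R := (2 * m + 1)%:R.
have -> : odd_pole_sum c m.+1 s =
    odd_pole_sum c m s + cst (c m) * (fun y => (y + a)^-1) ^+ s.
  apply/funext => y; rewrite /odd_pole_sum big_nat_recr //= fctE.
  by congr (_ + _); rewrite -[RHS]/(c m * _) exprfctE.
have xa0 : x + a != 0 by rewrite gt_eqF // odd_pole_gt0.
have dxa : is_derive x 1 (fun y : R => y + a) 1.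
  rewrite -[X in is_derive _ _ _ X]addr0.
  exact: (@is_deriveD _ _ _ id (cst a) x 1 1 0).
have dV := @is_deriveV R (fun y => y + a) x 1 1 xa0 dxa.
have dX := @is_deriveX _ _ _ s _ _ _ dV.
have dM := @is_deriveM _ _ _ _ _ _ _ _ (is_derive_cst (c m) x 1) dX.
have dD := @is_deriveD _ _ _ _ _ _ _ _ _ IH dM.
apply: is_derive_eq; rewrite /odd_pole_sum big_nat_recr //= mulrDr.
congr (_ + _); rewrite /GRing.scale /= -/a mulr0 addr0.
case: s {IH dX dM dD} => [|s]; first by rewrite !(mul0r, mulr0, oppr0).
rewrite /= expr2 invfM !exprS; ring.
Qed.

(** Termwise, [x + 2n + 3] splits as [(x + 2k + 1) + 2(n + 1 - k)], and [(n + 1 - k) 'C(n + 1, k) =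
    (n + 1) 'C(n, k)]. *)
Lemma alt_binomial_sum_rec {R : realType} n s {x : R} : -1 < x ->
  (x + (2 * n + 3)%:R) * alt_binomial_sum n.+1 s.+1 x =
  (2 * n + 2)%:R * alt_binomial_sum n s.+1 x + alt_binomial_sum n.+1 s x.
Proof.
move=> x1; rewrite /alt_binomial_sum /odd_pole_sum.
(* The added term vanishes with ['C(n, n.+1)]; all sums now have the same range. *)
have -> : \sum_(0 <= k < n.+1)
      'C(n, k)%:R * (-1) ^+ k * (x + (2 * k + 1)%:R)^-1 ^+ s.+1 =
    \sum_(0 <= k < n.+2)
      'C(n, k)%:R * (-1) ^+ k * (x + (2 * k + 1)%:R)^-1 ^+ s.+1.
  by rewrite [RHS]big_nat_recr //= bin_small // !mul0r addr0.
rewrite !mulr_sumr -big_split /=.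
apply: eq_big_nat => k /andP[_ kn].
have xk : x + (2 * k + 1)%:R != 0 by rewrite gt_eqF // odd_pole_gt0.
have E : (n.+1%:R : R) * 'C(n, k)%:R = (n.+1%:R - k%:R) * 'C(n.+1, k)%:R.
  by rewrite -natrB // -!natrM (mul_bin_down n.+1 k).
rewrite exprS; set u := (x + _)^-1 ^+ s; set w := (-1) ^+ k.
have -> : (2 * n + 2)%:R = 2 * n.+1%:R :> R by rewrite -natrM mulnS addnC.
transitivity (2 * (n.+1%:R * 'C(n, k)%:R) *
              (w * ((x + (2 * k + 1)%:R)^-1 * u)) + 'C(n.+1, k)%:R * w * u);
  last by ring.
rewrite E; move: xk; rewrite -(natr1 n) !(natrD _ (2 * _)) !natrM => xk.
by field.
Qed.

Lemma alt_binomial_sum0 {R : realType} s {x : R} :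
  alt_binomial_sum 0 s x = (x + 1)^-1 ^+ s.
Proof.
by rewrite /alt_binomial_sum /odd_pole_sum big_nat1 bin0 expr0 !mul1r.
Qed.

(** This is the expansion of [(1 - 1) ^+ n.+1]; it makes the recurrence at [s = 0] homogeneous. *)
Lemma alt_binomial_sum_order0 {R : realType} n (x : R) :
  alt_binomial_sum n.+1 0 x = 0.
Proof.
transitivity ((1 - 1 : R) ^+ n.+1); last by rewrite subrr expr0n.
rewrite exprBn /alt_binomial_sum /odd_pole_sum big_mkord; apply: eq_bigr => k _.
by rewrite !expr1n !expr0 !mulr1 mulr_natl.
Qed.

Lemma betanE {R : realType} n : @betan R n = odd_pole_sum (fun=> -1) n.+1 1.
Proof.
apply/funext => x; rewrite /betan /odd_pole_sum -sumrN.
by apply: eq_bigr => k _; rewrite expr1 mul1r mulN1r natrD natrM addrA.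
Qed.

(** The derivative of [y = alt_binomial_sum n 1] is minus the left side, so this is the equation
    [y' = betan n * y]. The induction combines the recurrence at [s = 0] and at [s = 1]. *)
Lemma alt_binomial_sum2 {R : realType} n {x : R} : -1 < x ->
  alt_binomial_sum n 2 x = - betan n x * alt_binomial_sum n 1 x.
Proof.
move=> x1; rewrite betanE; elim: n => [|n IH].
  by rewrite !alt_binomial_sum0 /odd_pole_sum big_nat1 expr2 expr1; ring.
have xn := odd_pole_gt0 n.+1 x1.
have r1 := alt_binomial_sum_rec n 0 x1.
have r2 := alt_binomial_sum_rec n 1 x1.
move: r1; rewrite alt_binomial_sum_order0 addr0 => r1.
rewrite IH in r2.
rewrite /odd_pole_sum big_nat_recr //= -/(odd_pole_sum _ _ _ _).
have e : (2 * n.+1 + 1 = 2 * n + 3)%N by rewrite mulnS; ring.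
rewrite e in xn *.
apply: (mulfI (lt0r_neq0 xn)); rewrite r2.
transitivity (- odd_pole_sum (fun=> -1) n.+1 1 x *
  ((2 * n + 2)%:R * alt_binomial_sum n 1 x) + alt_binomial_sum n.+1 1 x).
  by ring.
rewrite -r1 expr1; move: (lt0r_neq0 xn); move: (x + _) => y y0.
by field.
Qed.

Lemma fnsS {R : realType} n s {x : R} :
  fns n s.+2 x = betan n x * fns n s.+1 x + derive1 (fns n s.+1) x.
Proof. by []. Qed.

(* [alt_binomial_sum n 1] solves [y' = betan n * y], so its [s]-th derivative is
   [fns n s * y]. *)
Lemma alt_binomial_sum_fns {R : realType} n s {x : R} : -1 < x ->
  (-1) ^+ s.+1 * (s.+1`!)%:R * alt_binomial_sum n s.+2 x =
  fns n s.+1 x * alt_binomial_sum n 1 x.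
Proof.
elim: s x => [|s IH] x x1.
  rewrite alt_binomial_sum2 // -[fns n 1 x]/(betan n x) factS fact0 muln1 expr1.
  by ring.
pose y := @alt_binomial_sum R n 1.
have dl : is_derive x 1
    (cst ((-1) ^+ s.+1 * (s.+1`!)%:R) * @alt_binomial_sum R n s.+2)
    ((-1) ^+ s.+2 * (s.+2`!)%:R * alt_binomial_sum n s.+3 x).
  have d := @is_deriveM _ _ _ _ _ _ _ _
    (is_derive_cst ((-1) ^+ s.+1 * (s.+1`!)%:R : R) x 1)
    (is_derive_odd_pole_sum (fun k => 'C(n, k)%:R * (-1) ^+ k) n.+1 s.+2 x1).
  apply: is_derive_eq; rewrite /GRing.scale /= mulr0 addr0.
  by rewrite [s.+2`!]factS natrM !exprS /alt_binomial_sum; ring.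
have df : is_derive x 1 (fns n s.+1) (derive1 (fns n s.+1) x).
  by rewrite derive1E; apply/derivableP/derivable_fns.
have dy := is_derive_odd_pole_sum (fun k => 'C(n, k)%:R * (-1) ^+ k) n.+1 1 x1.
have dr := @is_deriveM _ _ _ _ _ _ _ _ df dy.
have := @derive_val _ _ _ _ _ _ _ dl.
(* The induction hypothesis holds only above -1, so it is differentiated as an equality near [x]. *)
rewrite (@near_eq_derive _ _ _ _ (fns n s.+1 * y)); last first.
  by near=> z; rewrite !fctE; apply: IH; near: z; exact: lt_nbhsr.
rewrite (@derive_val _ _ _ _ _ _ _ dr) => <-.
rewrite fnsS /GRing.scale /= -!/(alt_binomial_sum _ _ _) alt_binomial_sum2 //.
by ring.
Unshelve. all: by end_near. Qed.

(** By the homogeneous recurrence, each step multiplies the value by [(2n + 2) / (2n + 3)]. *)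
Lemma alt_binomial_sum_at0 {R : realType} n :
  alt_binomial_sum n 1 0 =
  2 ^+ (2 * n) / ((2 * n + 1)%:R * 'C(2 * n, n)%:R) :> R.
Proof.
elim: n => [|n IH].
  by rewrite alt_binomial_sum0 muln0 bin0 expr0 add0r invr1 expr1 !mulr1 divr1.
have x1 : -1 < 0 :> R by lra.
have := alt_binomial_sum_rec n 0 x1.
rewrite alt_binomial_sum_order0 addr0 add0r IH.
(* The ratio of consecutive central binomial coefficients. *)
have E : (n.+1 * 'C(2 * n.+1, n.+1) = 2 * (2 * n + 1) * 'C(2 * n, n))%N.
  have h1 := mul_bin_diag (2 * n).+2 n; have h2 := mul_bin_down (2 * n).+1 n.
  have -> : (2 * n.+1 = (2 * n).+2)%N by rewrite mulnS.
  by rewrite -h1 -[X in _ = X]mulnA addn1 h2 /=; nia.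
have /(congr1 (fun k => k%:R : R)) := E; rewrite !natrM => ER.
have b0 : 'C(2 * n, n)%:R != 0 :> R by rewrite pnatr_eq0 -lt0n bin_gt0; lia.
have n1 : (2 * n + 1)%:R != 0 :> R by rewrite pnatr_eq0 addn1.
have n0 : n.+1%:R != 0 :> R by rewrite pnatr_eq0.
have e3 : (2 * n.+1 + 1 = 2 * n + 3)%N by rewrite mulnS; lia.
have n3 : (2 * n + 3)%:R != 0 :> R by rewrite pnatr_eq0 addn3.
move=> r; apply: (mulfI n3); rewrite r e3.
have -> : (2 * n + 2 = 2 * n.+1)%N by lia.
have -> : 'C(2 * n.+1, n.+1)%:R =
    2 * (2 * n + 1)%:R * 'C(2 * n, n)%:R / n.+1%:R :> R.
  by rewrite -ER mulrC mulKf.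
rewrite (natrM _ 2 n.+1) mulnS exprD.
move: n1 n0 n3 b0.
move: (2 * n + 1)%:R n.+1%:R (2 * n + 3)%:R 'C(2 * n, n)%:R => u v w t.
move=> u0 v0 w0 t0.
by field; rewrite u0 v0 w0 t0.
Qed.

(** * Polynomial dependence on the derivatives of [betan] *)

Definition poly_in_derivs {R : realType} (b : nat -> R -> R) s (F : R -> R) :=
  exists p : mpoly s R, forall x : R, -1 < x -> F x = meval (fun j => b j x) p.

Section PolyInDerivs.
Context {R : realType} {b : nat -> R -> R}.

Lemma poly_in_derivs_cst s (c : R) : poly_in_derivs b s (cst c).
Proof. by exists (mpolyC s c) => x _; rewrite mevalC. Qed.

Lemma poly_in_derivs_var s j : (j < s)%N -> poly_in_derivs b s (b j).
Proof.
by move=> js; exists (mpolyX R (mnm1 (Ordinal js))) => x _; rewrite mevalXU.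
Qed.

Lemma poly_in_derivsD s F G : poly_in_derivs b s F -> poly_in_derivs b s G ->
  poly_in_derivs b s (F \+ G).
Proof.
by move=> [p Fp] [q Gq]; exists (p + q) => x x1; rewrite mevalD -Fp // -Gq.
Qed.

Lemma poly_in_derivsM s F G : poly_in_derivs b s F -> poly_in_derivs b s G ->
  poly_in_derivs b s (F \* G).
Proof.
by move=> [p Fp] [q Gq]; exists (p * q) => x x1; rewrite mevalM -Fp // -Gq.
Qed.

Hypothesis db : forall j (x : R), -1 < x -> is_derive x 1 (b j) (b j.+1 x).

(** Keeping the function and its derivative in the same class makes the property stable under
    products, by the Leibniz rule. *)
Let differentiable_in s (F : R -> R) := exists F' : R -> R,
  [/\ poly_in_derivs b s F, poly_in_derivs b s F' &
      forall x : R, -1 < x -> is_derive x 1 F (F' x)].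

Let dcst s c : differentiable_in s (cst c).
Proof.
exists (cst 0); split; try exact: poly_in_derivs_cst.
by move=> x _; exact: is_derive_cst.
Qed.

Let dadd s F G : differentiable_in s F -> differentiable_in s G ->
  differentiable_in s (F \+ G).
Proof.
move=> [F' [pF pF' dF]] [G' [pG pG' dG]]; exists (F' \+ G').
split; try exact: poly_in_derivsD.
by move=> x x1; have := dF x x1; have := dG x x1 => ? ?; exact: is_deriveD.
Qed.

Let dmul s F G : differentiable_in s F -> differentiable_in s G ->
  differentiable_in s (F \* G).
Proof.
move=> [F' [pF pF' dF]] [G' [pG pG' dG]].
exists ((F \* G') \+ (G \* F')); split; first exact: poly_in_derivsM.
  by apply: poly_in_derivsD; exact: poly_in_derivsM.
by move=> x x1; have := dF x x1; have := dG x x1 => ? ?; exact: is_deriveM.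
Qed.

(** One more variable is needed because [b s.-1] has derivative [b s]. The polynomial is rebuilt by
    induction on its support, the variables of a monomial and their exponents. *)
Lemma poly_in_derivs_derive s F : poly_in_derivs b s F ->
  exists F' : R -> R, [/\ poly_in_derivs b s.+1 F, poly_in_derivs b s.+1 F' &
    forall x : R, -1 < x -> is_derive x 1 F (F' x)].
Proof.
move=> [p Fp].
have [G' [[q Gq] pG' dG]] :
    differentiable_in s.+1 (fun x => meval (fun j : 'I_s => b j x) p).
  have -> : (fun x => meval (fun j : 'I_s => b j x) p) =
      fun x => \sum_(m <- msupp p) mcoeff m p * \prod_(i < s) b i x ^+ m i.
    by apply/funext => x; rewrite mevalE.
  elim: (msupp p) => [|m l IH].
    under eq_fun do rewrite big_nil.
    exact: dcst.
  under eq_fun do rewrite big_cons.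
  apply: dadd IH; apply: dmul; first exact: dcst.
  elim: (index_enum _) => [|i t IH].
    under eq_fun do rewrite big_nil.
    exact: dcst.
  under eq_fun do rewrite big_cons.
  apply: dmul IH; elim: (m i) => [|k IH].
    under eq_fun do rewrite expr0.
    exact: dcst.
  under eq_fun do rewrite exprS.
  apply: dmul IH; exists (b i.+1).
  by split; [apply: poly_in_derivs_var|apply: poly_in_derivs_var|exact: db];
    rewrite ltnS // ltnW.
exists G'; split=> // [|x x1]; first by exists q => x x1; rewrite Fp // Gq.
apply: near_eq_is_derive (dG x x1).
by near=> y; rewrite Fp //; near: y; exact: lt_nbhsr.
Unshelve. all: by end_near. Qed.

End PolyInDerivs.

Lemma is_derive_derive1n_betan {R : realType} n j {x : R} : -1 < x ->
  is_derive x 1 (derive1n j (@betan R n)) (derive1n j.+1 (betan n) x).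
Proof.
move=> x1; rewrite /derive1n iterS derive1E; apply/derivableP.
exact: derivable_derive1n_betan.
Qed.

Lemma fns_poly_in_derivs {R : realType} n s :
  poly_in_derivs (fun j => derive1n j (@betan R n)) s.+1 (fns n s.+1).
Proof.
elim: s => [|s IH]; first exact: (@poly_in_derivs_var _ _ 1 0).
have [F' [[p fp] pF' dF]] :=
  poly_in_derivs_derive (fun j x => @is_derive_derive1n_betan R n j x) _ _ IH.
have [q Fq] : poly_in_derivs (fun j => derive1n j (@betan R n)) s.+2
    ((betan n \* fns n s.+1) \+ F').
  apply: poly_in_derivsD pF'; apply: poly_in_derivsM; last by exists p.
  exact: (@poly_in_derivs_var _ _ s.+2 0).
exists q => x x1; rewrite -Fq // fnsS derive1E.
by rewrite (@derive_val _ _ _ _ _ _ _ (dF x x1)).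
Qed.

(** * Derivatives of [betan] at 0 and harmonic numbers *)

Lemma derive1n_betan {R : realType} n j (x : R) : -1 < x ->
  derive1n j (betan n) x =
  (-1) ^+ j.+1 * (j`!)%:R * odd_pole_sum (fun=> 1) n.+1 j.+1 x.
Proof.
elim: j x => [|j IH] x x1.
  rewrite /= betanE /odd_pole_sum mulr1 mulr_sumr.
  by apply: eq_bigr => k _; rewrite mul1r.
have d := @is_deriveM _ _ _ _ _ _ _ _
  (is_derive_cst ((-1) ^+ j.+1 * (j`!)%:R : R) x 1)
  (is_derive_odd_pole_sum (fun=> 1) n.+1 j.+1 x1).
rewrite /derive1n iterS -/(derive1n j _) derive1E.
rewrite (@near_eq_derive _ _ _ _
  (cst ((-1) ^+ j.+1 * (j`!)%:R) * odd_pole_sum (fun=> 1) n.+1 j.+1)).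
  rewrite (@derive_val _ _ _ _ _ _ _ d) /GRing.scale /= mulr0 addr0.
  by rewrite factS natrM !exprS; ring.
by near=> z; apply: IH; near: z; exact: lt_nbhsr.
Unshelve. all: by end_near. Qed.

(** Each step adds the denominators [2n + 2] and [2n + 3] to the first harmonic number; the even one
    is cancelled by the new term of the second. *)
Lemma sum_odd_powers_harmonic {R : realType} n s :
  \sum_(0 <= k < n.+1) ((2 * k + 1)%:R : R)^-1 ^+ s =
  harmonic_number (2 * n + 1) s - 1 / 2 ^+ s * harmonic_number n s.
Proof.
rewrite /harmonic_number; elim: n => [|n IH].
  rewrite muln0 add0n !big_nat1 big_nil mulr0 subr0.
  by rewrite !expr1n invr1 expr1n mulr1.
have e : (2 * n.+1 + 1 = (2 * n + 1).+2)%N by lia.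
rewrite big_nat_recr //= IH e (big_nat_recr (2 * n + 1).+2) //=.
rewrite (big_nat_recr (2 * n + 1).+1) //= (big_nat_recr n.+1) //=.
have -> : (2 * n + 1).+1%:R = 2 * n.+1%:R :> R.
  by rewrite -natrM; congr _%:R; lia.
rewrite exprMn exprVn.
have : n.+1%:R ^+ s != 0 :> R by rewrite expf_neq0 // pnatr_eq0.
have : (2 : R) ^+ s != 0 by rewrite expf_neq0 // pnatr_eq0.
have : (2 * n + 1).+2%:R ^+ s != 0 :> R by rewrite expf_neq0 // pnatr_eq0.
move: (_.+2%:R ^+ s) (2 ^+ s) (n.+1%:R ^+ s) => u v w u0 v0 w0.
by field; rewrite u0 v0 w0.
Qed.

(** * Summation of the series *)

(** The recurrence at 0 has nonnegative coefficients, so positivity propagates by induction on [s],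
    then on [n]. *)
Lemma alt_binomial_sum_ge0 {R : realType} n s :
  0 <= alt_binomial_sum n s 0 :> R.
Proof.
have x1 : -1 < 0 :> R by lra.
elim: s n => [|s IHs] [|n].
- by rewrite alt_binomial_sum0 expr0.
- by rewrite alt_binomial_sum_order0.
- by rewrite alt_binomial_sum0 add0r invr1 expr1n.
- elim: n.+1 => [|m IHm].
    by rewrite alt_binomial_sum0 add0r invr1 expr1n.
  rewrite -(@pmulr_rge0 _ (0 + (2 * m + 3)%:R)) ?add0r ?ltr0n ?addn3 //.
  have := alt_binomial_sum_rec m s x1; rewrite add0r addn3 => ->.
  by rewrite addr_ge0 // mulr_ge0.
Qed.

(** Term [m] belongs to [n = m + 1], so the weight [1 / (2n)] never divides by zero. *)
Definition weighted_alt_sum {R : realType} s N : R :=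
  \sum_(0 <= m < N) alt_binomial_sum m.+1 s 0 / (2 * m.+1%:R).

Lemma weighted_alt_sum0 {R : realType} N : weighted_alt_sum 0 N = 0 :> R.
Proof.
rewrite /weighted_alt_sum big1 // => m _.
by rewrite alt_binomial_sum_order0 mul0r.
Qed.

(** The recurrence divided by [2 (N + 1)] telescopes; the [1] is the initial value
    [alt_binomial_sum 0 s.+1 0]. *)
Lemma weighted_alt_sumS {R : realType} s N :
  weighted_alt_sum s.+1 N =
  weighted_alt_sum s N + 1 - alt_binomial_sum N s.+1 0 :> R.
Proof.
have x1 : -1 < 0 :> R by lra.
elim: N => [|N IH].
  rewrite /weighted_alt_sum !big_nil alt_binomial_sum0 add0r invr1 expr1n.
  by rewrite subrr.
rewrite /weighted_alt_sum !big_nat_recr //= -!/(weighted_alt_sum _ _) IH.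
have := alt_binomial_sum_rec N s x1.
have -> : (2 * N + 2 = 2 * N.+1)%N by lia.
have -> : (2 * N + 3 = 2 * N.+1 + 1)%N by lia.
rewrite add0r natrD natrM.
have : N.+1%:R != 0 :> R by rewrite pnatr_eq0.
move: N.+1%:R (alt_binomial_sum N.+1 s.+1 0) => c a c0 E.
have -> : alt_binomial_sum N.+1 s 0 =
    (2 * c + 1) * a - 2 * c * alt_binomial_sum N s.+1 0 by rewrite E; ring.
by field.
Qed.

Lemma nondecreasing_weighted_alt_sum {R : realType} s :
  nondecreasing_seq (@weighted_alt_sum R s).
Proof.
apply/nondecreasing_seqP => N; rewrite /weighted_alt_sum big_nat_recr //= lerDl.
by rewrite divr_ge0 ?alt_binomial_sum_ge0 // mulr_ge0.
Qed.

Lemma weighted_alt_sum_le {R : realType} s N :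
  weighted_alt_sum s N <= s%:R :> R.
Proof.
elim: s => [|s IH]; first by rewrite weighted_alt_sum0.
rewrite weighted_alt_sumS -natr1 lerBlDr.
by have := alt_binomial_sum_ge0 (R := R) N s.+1; lra.
Qed.

Lemma cvgn_weighted_alt_sum {R : realType} s : cvgn (@weighted_alt_sum R s).
Proof.
apply: nondecreasing_is_cvgn; first exact: nondecreasing_weighted_alt_sum.
by exists s%:R => _ [N _ <-]; exact: weighted_alt_sum_le.
Qed.

(* The limit exists by the previous identity; were it positive, the convergent
   series [\sum_m alt_binomial_sum m s.+1 0 / m] would dominate the harmonic
   one. *)
Lemma cvg_alt_binomial_sum {R : realType} s :
  alt_binomial_sum N s.+1 (0 : R) @[N --> \oo] --> (0 : R).
Proof.
have cS := @cvgn_weighted_alt_sum R s.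
have cS1 := @cvgn_weighted_alt_sum R s.+1.
have ca : cvgn (fun N => alt_binomial_sum N s.+1 (0 : R)).
  have -> : (fun N => alt_binomial_sum N s.+1 (0 : R)) =
      (fun N => weighted_alt_sum s N + 1 - weighted_alt_sum s.+1 N).
    by apply/funext => N; rewrite weighted_alt_sumS; ring.
  apply: is_cvgB => //; apply: is_cvgD => //; exact: is_cvg_cst.
set L := limn (fun N => alt_binomial_sum N s.+1 (0 : R)).
have L0 : 0 <= L.
  by apply: limr_ge => //; near=> N; exact: alt_binomial_sum_ge0.
have cL : alt_binomial_sum N s.+1 (0 : R) @[N --> \oo] --> L by exact: ca.
suff L00 : L = 0 by rewrite L00 in cL.
apply/eqP; rewrite eq_le L0 andbT leNgt; apply/negP => Lpos.
have [M _ HM] : \forall N \near \oo, L / 2 < alt_binomial_sum N s.+1 (0 : R).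
  by apply: (cvgr_gt L ca); lra.
apply: (@dvg_harmonic R).
(* Only the tail from [M] on matters, where the terms exceed [L / 2]. *)
rewrite -(is_cvg_series_restrict M).
apply: nondecreasing_is_cvgn.
  apply/nondecreasing_seqP => N /=; have [MN|NM] := leqP M N.
    by rewrite big_nat_recr //= lerDl.
  by rewrite big_geq ?sumr_ge0 // ltnW.
(* In [4 / L], one factor 2 undoes the threshold [L / 2], the other the weight [1 / (2n)]. *)
exists (4 / L * s.+1%:R) => _ [N _ <-] /=.
have [NM|MN] := leqP N M; first by rewrite big_geq // mulr_ge0 ?divr_ge0.
apply: (@le_trans _ _ (4 / L * weighted_alt_sum s.+1 N)); last first.
  by rewrite ler_wpM2l ?divr_ge0 ?weighted_alt_sum_le.
rewrite /weighted_alt_sum [X in _ <= _ * X](@big_cat_nat _ _ _ M) //=;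
  last exact: ltnW.
rewrite mulrDr -[leLHS]add0r lerD //.
  rewrite mulr_ge0 ?divr_ge0 // sumr_ge0 // => k _.
  by rewrite divr_ge0 ?alt_binomial_sum_ge0 // mulr_ge0.
rewrite mulr_sumr; apply: ler_sum_nat => k /andP[Mk _].
have /HM ak : (M <= k.+1)%N by exact: leqW.
have -> : 4 / L * (alt_binomial_sum k.+1 s.+1 0 / (2 * k.+1%:R)) =
    (alt_binomial_sum k.+1 s.+1 0 / (L / 2)) * k.+1%:R^-1.
  have : k.+1%:R != 0 :> R by rewrite pnatr_eq0.
  by move: k.+1%:R => v v0; field; rewrite v0 lt0r_neq0.
rewrite ler_peMl ?invr_ge0 // ler_pdivlMr ?mul1r ?ltW //.
by rewrite divr_gt0.
Unshelve. all: by end_near. Qed.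

Lemma cvg_weighted_alt_sum {R : realType} s :
  weighted_alt_sum s N @[N --> \oo] --> (s%:R : R).
Proof.
elim: s => [|s IH].
  rewrite (_ : weighted_alt_sum 0 = cst 0); first exact: cvg_cst.
  by apply/funext => N; rewrite weighted_alt_sum0.
rewrite (_ : weighted_alt_sum s.+1 =
    fun N => weighted_alt_sum s N + 1 - alt_binomial_sum N s.+1 0); last first.
  by apply/funext => N; rewrite weighted_alt_sumS.
rewrite -[X in _ --> X]subr0 -(natr1 s).
apply: cvgB; last exact: cvg_alt_binomial_sum.
by apply: cvgD => //; exact: cvg_cst.
Qed.

(** * The finite identity, the series, polynomiality and the values at 0 *)

Theorem theorem1 (R : realType) (n r : nat) (hn : (0 < n)%N) (hr : (0 < r)%N) :
  [/\ (-1) ^+ r * (r`!)%:R *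
        (\sum_(0 <= k < n.+1)
           'C(n, k)%:R * (-1) ^+ k * (1 / (2 * k + 1)%:R ^+ r.+1)) =
      2 ^+ (2 * n) / ((2 * n + 1)%:R * 'C(2 * n, n)%:R) * fns n r (0 : R),
      (\sum_(1 <= m < N)
         2 ^+ (2 * m - 1) / (m%:R * (2 * m + 1)%:R * 'C(2 * m, m)%:R) *
         fns m r (0 : R)) @[N --> \oo] -->
        ((-1) ^+ r * ((r.+1)`!)%:R : R),
      forall s : nat, (0 < s)%N ->
        exists p : mpoly.mpoly s R, forall x : R, -1 < x ->
          fns n s x =
          mpoly.meval (fun j : 'I_s => derive1n j (betan n) x) p
    & forall j : nat,
        derive1n j (betan n) (0 : R) =
        (-1) ^ (j%:Z - 1) * (j`!)%:R *
        (harmonic_number (2 * n + 1) j.+1 -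
         1 / 2 ^+ j.+1 * harmonic_number n j.+1)].
Proof.
have x1 : -1 < 0 :> R by lra.
(* Both sides are the [r]-th derivative of [alt_binomial_sum m 1] at 0. *)
have fnsE m :
    2 ^+ (2 * m) / ((2 * m + 1)%:R * 'C(2 * m, m)%:R) * fns m r (0 : R) =
    (-1) ^+ r * (r`!)%:R * alt_binomial_sum m r.+1 0.
  case: r hr => // s _; rewrite alt_binomial_sum_fns // -alt_binomial_sum_at0.
  by rewrite mulrC.
split=> [||s|j].
- rewrite fnsE; congr (_ * _); rewrite /alt_binomial_sum /odd_pole_sum.
  by apply: eq_bigr => k _; rewrite add0r div1r exprVn.
- rewrite -cvg_shiftS.
  (* As [2^(2m-1) / m = 2^(2m) / (2m)], the weights are those of [weighted_alt_sum], whose limit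
     [r.+1] turns [r!] into [(r+1)!]. *)
  rewrite (_ : (fun N => _) =
      fun N => (-1) ^+ r * (r`!)%:R * weighted_alt_sum r.+1 N).
    rewrite factS mulnC natrM mulrA.
    by apply: cvgM; [exact: cvg_cst | exact: cvg_weighted_alt_sum].
  apply/funext => N; rewrite /= big_add1 /= /weighted_alt_sum mulr_sumr.
  apply: eq_bigr => m _; rewrite mulrA -fnsE.
  have -> : (2 * m.+1 - 1 = (2 * m).+1)%N by lia.
  have -> : 2 ^+ (2 * m.+1) = 2 * 2 ^+ (2 * m).+1 :> R by rewrite -exprS mulnS.
  have b0 : 'C(2 * m.+1, m.+1)%:R != 0 :> R.
    by rewrite pnatr_eq0 -lt0n bin_gt0; lia.
  have m0 : m.+1%:R != 0 :> R by rewrite pnatr_eq0.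
  have m1 : (2 * m.+1 + 1)%:R != 0 :> R by rewrite pnatr_eq0 addn1.
  move: b0 m0 m1.
  move: 'C(2 * m.+1, m.+1)%:R m.+1%:R (2 * m.+1 + 1)%:R => u v w u0 v0 w0.
  by field; rewrite u0 v0 w0.
- by case: s => // s _; exact: fns_poly_in_derivs.
- rewrite derive1n_betan // -sum_odd_powers_harmonic; congr (_ * _ * _).
    (* At [j = 0] the integer exponent is -1 and the sign is its own inverse; otherwise the two
       exponents differ by 2. *)
    case: j => [|j]; first by rewrite expr1 sub0r exprN1 invrN1.
    by rewrite intS addrAC subrr add0r -exprnP !exprS; ring.
  by apply: eq_bigr => k _; rewrite mul1r add0r.
Qed.
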